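(* Let $I$ be a countably infinite index set and let $X$ be a Banach sequence space over $I$ in which $(e_i)_{i\in I}$ is an OP-basis. Let $N\geq 2$ and let integers $1\leq r_1<r_2<\cdots<r_N$ be given. For each $1\leq l\leq N$, let $T_l=T_{b^{(l)},\varphi_l}:X\to X$ be a weighted pseudo-shift with weight sequence $b^{(l)}=(b^{(l)}_i)_{i\in I}$ and injective mapping $\varphi_l:I\to I$, and let $\psi_l=\varphi_l^{-1}:\varphi_l(I)\to I$. Assume that for all $1\leq s<l\leq N$ the sequence $((\varphi_s^{r_s})^n)_n$ is run-away with $((\varphi_l^{r_l})^n)_n$. Then the following are equivalent: (1) $T_1^{r_1},T_2^{r_2},\ldots,T_N^{r_N}$ are densely d-hypercyclic. (2) Both of the following hold: $(\alpha)$ For each $1\leq l\leq N$, the mapping $\varphi_l:I\to I$ has no periodic points. $(\beta)$ There exists an increasing sequence $(n_k)_{k\geq 1}$ of positive integers such that for every $i\in I$: for all $1\leq l\leq N$, $$\lim_{k\to\infty}\left\|\left(\prod_{v=0}^{r_ln_k-1}b^{(l)}_{\varphi_l^v(i)}\right)^{-1}e_{\varphi_l^{r_ln_k}(i)}\right\|=0,\qquad \lim_{k\to\infty}\left\|\left(\prod_{v=1}^{r_ln_k}b^{(l)}_{\psi_l^v(i)}\right)e_{\psi_l^{r_ln_k}(i)}\right\|=0;$$ and for all $1\leq s<l\leq N$, $$\lim_{k\to\infty}\left\|\left(\prod_{v=0}^{r_sn_k-1}b^{(s)}_{\varphi_s^v(i)}\right)^{-1}\left(\prod_{v=1}^{r_ln_k}b^{(l)}_{\psi_l^v(\varphi_s^{r_sn_k}(i))}\right)e_{\psi_l^{r_ln_k}(\varphi_s^{r_sn_k}(i))}\right\|=0,$$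 $$\lim_{k\to\infty}\left\|\left(\prod_{v=0}^{r_ln_k-1}b^{(l)}_{\varphi_l^v(i)}\right)^{-1}\left(\prod_{v=1}^{r_sn_k}b^{(s)}_{\psi_s^v(\varphi_l^{r_ln_k}(i))}\right)e_{\psi_s^{r_sn_k}(\varphi_l^{r_ln_k}(i))}\right\|=0.$$ (3) $T_1^{r_1},T_2^{r_2},\ldots,T_N^{r_N}$ satisfy the d-Hypercyclicity Criterion.
   Context: Scalars are complex; $\mathbb{N}=\{0,1,2,\ldots\}$; $L(X)$ denotes the continuous linear operators on $X$; ''increasing'' for a sequence of integers means strictly increasing. Banach sequence space over $I$: a linear subspace $X$ of $\mathbb{C}^I$ endowed with a norm making it a Banach space such that every coordinate functional $(x_k)_{k\in I}\mapsto x_i$ ($i\in I$) is continuous on $X$. OP-basis: let $e_i=(\delta_{ik})_{k\in I}$ be the canonical unit vectors, assumed to lie in $X$. $(e_i)_{i\in I}$ is an OP-basis if $\mathrm{span}\{e_i:i\in I\}$ is dense in $X$ and the family of coordinate projections $x\mapsto x_ie_i$ ($i\in I$) on $X$ is equicontinuous. Weighted pseudo-shift: a continuous linear operator $T=T_{b,\varphi}:X\to X$ of the form $T(x_i)_{i\in I}=(b_ix_{\varphi(i)})_{i\in I}$, where $b=(b_i)_{i\in I}$ is a sequence of non-zero scalars (the weight sequence) and $\varphi:I\to I$ is injective. Conventions: $\varphi^n$ is the $n$-fold composition of $\varphi$. With $\psi=\varphi^{-1}:\varphi(I)\to I$, $\psi^n$ is the $n$-fold composition of the partially defined map $\psi$;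 whenever $\psi^n(i)$ is undefined one sets $b_{\psi^n(i)}=0$ and $e_{\psi^n(i)}=0$. The same conventions apply to each $\varphi_l,\psi_l,b^{(l)}$. Run-away: for maps $\varphi_1,\varphi_2:I\to I$, the sequence $(\varphi_1^n)_n$ is run-away with $(\varphi_2^n)_n$ if for every finite $I_0\subset I$ there is $n_0\in\mathbb{N}$ such that $\varphi_1^n(I_0)\cap\varphi_2^n(I_0)=\emptyset$ for every $n\geq n_0$. d-hypercyclicity: a hypercyclic operator is one having a vector with dense orbit. For $N\geq 2$, hypercyclic operators $T_1,\ldots,T_N\in L(X)$ are d-hypercyclic if there is $x\in X$ such that $\{(T_1^nx,\ldots,T_N^nx):n\in\mathbb{N}\}$ is dense in $X^N$; such an $x$ is a d-hypercyclic vector. They are densely d-hypercyclic if the set of d-hypercyclic vectors is dense in $X$. d-Hypercyclicity Criterion: $T_1,\ldots,T_N\in L(X)$ satisfy it with respect to a strictly increasing sequence $(n_k)_k$ of positive integers if there exist dense subsets $X_0,X_1,\ldots,X_N$ of $X$ and mappings $S_{l,k}:X_l\to X$ ($1\leq l\leq N$, $k\in\mathbb{N}$) such that, as $k\to\infty$, for $1\le l\le N$: $T_l^{n_k}\to 0$ pointwise on $X_0$; $S_{l,k}\to 0$ pointwise on $X_l$; and $T_l^{n_k}S_{i,k}-\delta_{i,l}\mathrm{Id}_{X_i}\to 0$ pointwise on $X_i$ for $1\leq i\leq N$. They satisfy the d-Hypercyclicity Criterion if they do so with respect to some such sequence. *)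

(* Defs.v *)
From HB Require Import structures.
From mathcomp Require Import all_boot all_order all_algebra complex.
From mathcomp Require Import all_classical all_reals all_analysis.

Set Implicit Arguments.
Unset Strict Implicit.
Unset Printing Implicit Defensive.

Import Order.TTheory GRing.Theory Num.Theory.
Import numFieldNormedType.Exports.

Local Open Scope classical_set_scope.
Local Open Scope ring_scope.

(* The complex field is R[i] for R : realType.  Norms on a normed module over
   R[i] take their values in R[i] (as nonnegative reals), and R[i]^o is R[i]
   with its usual topology. *)

(* A linear subspace of C^I with a Banach norm is presented as a Banach space
   together with the linear injection x |-> (bss_coord i x)_i into C^I; the
   set of sequences is the range of this injection. *)
Record banachSeqSpace (R : realType) (I : Type) := BanachSeqSpace {
  bss_space :> completeNormedModType R[i];
  bss_coord : I -> {linear bss_space -> (R[i])^o};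
  bss_coord_inj :
    forall x y, (forall i, bss_coord i x = bss_coord i y) -> x = y;
  bss_coord_continuous : forall i, continuous (bss_coord i)
}.

Section SequenceSpace.
Context {R : realType} {I : countType} {X : banachSeqSpace R I}.

(* By injectivity of the coordinates there is at most one such e. *)
Definition unit_vectors (e : I -> X) : Prop :=
  forall i k, bss_coord X k (e i) = (i == k)%:R.

Definition lin_span (e : I -> X) : set X :=
  [set x | exists (s : seq I) (c : I -> R[i]), x = \sum_(i <- s) c i *: e i].

Definition OP_basis (e : I -> X) : Prop :=
  [/\ unit_vectors e,
      dense (lin_span e) &
      equicontinuous [set: I] (fun i (x : X) => bss_coord X i x *: e i)].

Definition weighted_pseudo_shift (b : I -> R[i]) (phi : I -> I)
    (T : {linear X -> X}) : Prop :=
  [/\ continuous T,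
      forall i, b i != 0,
      injective phi &
      forall x i, bss_coord X i (T x) = b i * bss_coord X (phi i) x].

End SequenceSpace.

Section PseudoShiftIterates.
Context {I : Type}.

(* The inverse phi(I) -> I of an injective phi; None outside phi(I). *)
Definition partial_inverse (phi : I -> I) (i : I) : option I :=
  if pselect (exists j, phi j = i) is left h then Some (sval (cid h)) else None.

Definition psi_iter (phi : I -> I) (n : nat) (i : I) : option I :=
  iter n (obind (partial_inverse phi)) (Some i).

Definition periodic_point (phi : I -> I) (i : I) : Prop :=
  exists2 n, (0 < n)%N & iter n phi i = i.

Definition run_away (phi1 phi2 : I -> I) : Prop :=
  forall I0 : set I, finite_set I0 ->
    exists n0, forall n, (n0 <= n)%N ->
      (iter n phi1 @` I0) `&` (iter n phi2 @` I0) = set0.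

Definition fwd_weight {K : comNzRingType} (b : I -> K) (phi : I -> I)
    (m : nat) (i : I) : K :=
  \prod_(0 <= v < m) b (iter v phi i).

(* [oapp b 0] and [oapp e 0] implement the conventions b_{psi^n(i)} = 0 and
   e_{psi^n(i)} = 0 when psi^n(i) is undefined. *)
Definition bwd_weight {K : comNzRingType} (b : I -> K) (phi : I -> I)
    (m : nat) (i : I) : K :=
  \prod_(1 <= v < m.+1) oapp b 0 (psi_iter phi v i).

Definition bwd_vector {V : nmodType} (e : I -> V) (phi : I -> I)
    (m : nat) (i : I) : V :=
  oapp e 0 (psi_iter phi m i).

End PseudoShiftIterates.

Section Dynamics.
Context {K : numFieldType} {X : normedModType K}.

Definition hypercyclic (T : X -> X) : Prop :=
  exists x, dense (range (fun n => iter n T x)).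

(* {ptws 'I_N -> X} is the product space X^N with the product topology. *)
Definition d_hypercyclic_vector {N : nat} (T : 'I_N -> X -> X) (x : X) : Prop :=
  dense (range (fun n => (fun l => iter n (T l) x) : {ptws 'I_N -> X})).

Definition d_hypercyclic {N : nat} (T : 'I_N -> X -> X) : Prop :=
  (forall l, hypercyclic (T l)) /\ exists x, d_hypercyclic_vector T x.

Definition densely_d_hypercyclic {N : nat} (T : 'I_N -> X -> X) : Prop :=
  d_hypercyclic T /\ dense [set x | d_hypercyclic_vector T x].

Definition increasing_positive (n : nat -> nat) : Prop :=
  {homo n : j k / (j < k)%N} /\ forall k, (0 < n k)%N.

(* The maps S_{l,k} : X_l -> X are given by total functions; only their values
   on X_l = Xl l are constrained. *)
Definition d_hypercyclicity_criterion_wrt {N : nat} (T : 'I_N -> X -> X)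
    (n : nat -> nat) : Prop :=
  exists (X0 : set X) (Xl : 'I_N -> set X) (S : 'I_N -> nat -> X -> X),
    [/\ dense X0 /\ (forall l, dense (Xl l)),
        forall l x, X0 x -> iter (n k) (T l) x @[k --> \oo] --> (0 : X),
        forall l x, Xl l x -> S l k x @[k --> \oo] --> (0 : X) &
        forall l i x, Xl i x ->
          (iter (n k) (T l) (S i k x) - (i == l)%:R *: x) @[k --> \oo]
            --> (0 : X)].

Definition d_hypercyclicity_criterion {N : nat} (T : 'I_N -> X -> X) : Prop :=
  exists n : nat -> nat,
    increasing_positive n /\ d_hypercyclicity_criterion_wrt T n.

(* Norms live in K, hence convergence in K^o. *)
Definition vanishes_in_norm (u : nat -> X) : Prop :=
  (`|u k| : K^o) @[k --> \oo] --> (0 : K^o).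

End Dynamics.

(* Main.v *)
Require Import Defs.
From HB Require Import structures.
From mathcomp Require Import all_boot all_order all_algebra complex.
From mathcomp Require Import all_classical all_reals all_analysis.
Set Implicit Arguments.
Unset Strict Implicit.
Unset Printing Implicit Defensive.
Import Order.TTheory GRing.Theory Num.Theory.
Import numFieldNormedType.Exports.
Local Open Scope classical_set_scope.
Local Open Scope ring_scope.

(** Coordinatewise, the [m]-th iterate of a weighted pseudo-shift multiplies
    the coordinate at [iter m phi i] by [W i = fwd_weight b phi m i] and moves
    it to [i] ([coord_iter]).  Dually it sends [e (iter m phi j)] to
    [W j *: e j] and kills the unit vectors outside the range of [iter m phi];
    both cases together are the vector
    [bwd_weight b phi m i *: bwd_vector e phi m i] ([iter_unit_vector]).
    Hence, for the powers [T_l^(r_l n)], the vanishing conditions speak of the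
    images [T_l^(r_l n) e_i], of the natural preimages of the [e_i], and of the
    images of these preimages under the other operators.

    Dense d-hypercyclicity excludes periodic points: at a point [i] of period
    [p] of [phi_l], the numbers [a m = (T_l^m x)_i] satisfy
    [a (p + m) = q * a m] for a constant [q].  Such a sequence is bounded when
    [|q| <= 1], and bounded away from [0] off its zeros when [|q| >= 1], so it
    is not dense in the scalars ([hypercyclic_no_periodic]).

    Dense d-hypercyclicity also gives the vanishing conditions.  Fix a finite
    set [F] of indices and let [z] be the sum of [e_i] over [F].  Take a
    d-hypercyclic vector [x] close to [z], and then [n] such that every
    [T_l^(r_l n) x] is close to [c z], with a scalar [c >= 1] chosen so large
    that [n] is forced to be large.  By equicontinuity of the coordinate
    projections, the components [x_j e_j] and [(T_l^(r_l n) x)_j e_j] are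
    uniformly small for [j] outside [F], whereas the coordinates at indices of
    [F] are at least [1/2] in modulus.  For large [n], the absence of periodic
    points and the run-away property put the unit vectors of the vanishing
    conditions at indices outside [F].  Each vector to be estimated is then one
    of those small components divided by a coordinate of modulus at least
    [1/2], so it is small ([terms_lt_of_approx], [exists_terms_lt]).  Letting
    [F] exhaust [I] gives the sequence [n_k] ([vanishing_sequence]).

    The vanishing conditions give the criterion when all its dense sets are the
    linear span of the unit vectors and [S_{l,k}] sends [e_i] to its natural
    preimage under [T_l^(r_l n_k)] ([criterion_of_terms]).

    The criterion brings [y_0 + sum_i S_{i,k} y_i] close to an arbitrary point
    while its images under the powers of the [T_l] come close to arbitrary
    targets ([criterion_approx]).  The space is separable, so the set of
    d-hypercyclic vectors contains a countable intersection of dense open sets,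
    and Baire's theorem makes it dense ([criterion_densely_d_hypercyclic]). *)

(** * Baire's theorem and density over the complex field *)

Lemma complex_invn_lt (R : realType) (a : R[i]) :
  0 < a -> exists n, n.+1%:R^-1 < a.
Proof.
move=> a0; have aR : a \is Num.real by exact: gtr0_real.
have := RRe_real aR; set t := complex.Re a => ta.
rewrite -ta in a0 *; have t0 : 0 < t by rewrite -ltcR.
exists (Num.truncn t^-1).
rewrite -[n in n^-1](rmorph_nat (real_complex R)) -fmorphV ltcR.
by rewrite -ltf_pV2 ?(posrE,invr_gt0)// invrK truncnS_gt.
Qed.

Section Baire.
Context {R : realType} {U : completeNormedModType R[i]}.

Let rad (n : nat) : R[i] := n.+1%:R^-1.

Let rad_gt0 n : 0 < rad n. Proof. by rewrite invr_gt0 ltr0n. Qed.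

Let rad_le m n : (m <= n)%N -> rad n <= rad m.
Proof. by move=> mn; rewrite lef_pV2 ?posrE ?ltr0n// ler_nat. Qed.

(** Radii of the form [1 / n.+1] are compared through their indices, since the
    order of [R[i]] is only partial. *)
Let inner_ball (O : set U) (x : U) (k : nat) : open O -> O x ->
  exists m, (k <= m)%N /\ forall y, `|x - y| <= rad m -> O y.
Proof.
move=> oO Ox; have /nbhs_normP[d /= d0 dO] : nbhs x O by exact: open_nbhs_nbhs.
have [n nd] := complex_invn_lt d0.
exists (maxn k n); split; first exact: leq_maxl.
move=> y xy; apply: dO => /=; rewrite (le_lt_trans xy)//.
by rewrite (le_lt_trans _ nd)// rad_le// leq_maxr.
Qed.

(** Closed balls with radii tending to [0] are nested, each inside the
    next dense open set; completeness yields a point common to all of them. *)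
Lemma complex_Baire (F : nat -> set U) :
  (forall n, open (F n) /\ dense (F n)) -> dense (\bigcap_n F n).
Proof.
move=> odF D D0 oD.
have [a0 [Da0 Fa0]] := proj2 (odF 0%N) D D0 oD.
have [m0 [_ m0P]] := inner_ball 0 (openI oD (proj1 (odF 0%N))) (conj Da0 Fa0).
pose P (n : nat) (p q : U * nat) := (n <= q.2)%N /\
  forall y, `|q.1 - y| <= rad q.2 -> `|p.1 - y| < rad p.2 /\ F n y.
have step (s : nat * (U * nat)) : exists q, P s.1.+1 s.2 q.
  case: s => n [a m]; have [oF dF] := odF n.+1.
  have oB : open (ball a (rad m)) by exact: ball_open.
  have B0 : ball a (rad m) !=set0 by exists a; exact: ballxx.
  have [a' [Ba' Fa']] := dF _ B0 oB.
  have [m' [nm' m'P]] := inner_ball n.+1 (openI oB oF) (conj Ba' Fa').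
  exists (a', m'); split => //= y /m'P[].
  by rewrite -ball_normE.
have [f fP] := choice step.
pose fix ar n := if n is p.+1 then f (p, ar p) else (a0, m0).
have arP n : P n.+1 (ar n) (ar n.+1) by exact: (fP (n, ar n)).
pose a n := (ar n).1; pose r n := rad (ar n).2.
have nest n k y : `|a (n + k)%N - y| <= r (n + k)%N -> `|a n - y| <= r n.
  elim: k => [|k IH]; first by rewrite addn0.
  by rewrite addnS => /(proj2 (arP _))[/ltW /IH].
have r_gt0 n : 0 < r n by exact: rad_gt0.
have nesta n m : (n <= m)%N -> `|a n - a m| <= r n.
  by move=> nm; apply: (nest n (m - n)%N); rewrite subnKC// subrr normr0 ltW.
have : cvg (a @ \oo).
  apply: cauchy_cvg; apply: cauchy_exP => d /= d0.
  have [n nd] := complex_invn_lt d0.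
  exists (a n.+1); exists n.+1 => // m /= nm.
  rewrite -ball_normE /=; apply: (le_lt_trans (nesta _ _ nm)).
  apply: le_lt_trans nd; apply: rad_le; apply: ltnW.
  exact: (proj1 (arP n)).
rewrite cvg_ex /= => -[l al]; exists l.
have lP n : `|a n - l| <= r n.
  apply/ler_addgt0Pr => d d0; move/cvgrPdist_lt : al => /(_ d d0) [k _ kP].
  apply: (le_trans (ler_distD (a (maxn n k)) _ _)); apply: lerD.
    exact/nesta/leq_maxl.
  by rewrite distrC ltW//; apply: kP => /=; exact: leq_maxr.
split; first by have [] := m0P _ (lP 0%N).
case=> [|n] _; first by have [] := m0P _ (lP 0%N).
by have [] := proj2 (arP n) _ (lP n.+1).
Qed.

End Baire.

Lemma dense_normP (K : numFieldType) (V : normedModType K) (A : set V) :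
  dense A <-> forall x (d : K), 0 < d -> exists2 y, A y & `|x - y| < d.
Proof.
split => [dA x d d0|dA O [x Ox] oO].
  have B0 : ball x d !=set0 by exists x; exact: ballxx.
  have [y [By Ay]] := dA _ B0 (ball_open x d); exists y => //.
  by rewrite -ball_normE in By.
have /nbhs_normP[d /= d0 dO] : nbhs x O by exact: open_nbhs_nbhs.
by have [y Ay xy] := dA x d d0; exists y; split => //; exact: dO.
Qed.

(** As there are finitely many operators, the boxes of a common radius form a
    basis of neighbourhoods for the product topology. *)
Lemma d_hypercyclic_vectorP (K : numFieldType) (V : normedModType K) (N : nat)
    (T : 'I_N -> V -> V) (x : V) :
  d_hypercyclic_vector T x <->
  forall (y : 'I_N -> V) (d : K), 0 < d ->
    exists n, forall l, `|y l - iter n (T l) x| < d.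
Proof.
split => [dT y d d0|dT O [y Oy] oO].
  pose B : set {ptws 'I_N -> V} := [set g | forall l, `|y l - g l| < d].
  have yB : nbhs (y : {ptws 'I_N -> V}) B.
    have FF : Filter (nbhs (y : {ptws 'I_N -> V})) by exact: nbhs_filter.
    apply: (@filter_forall _ _
      (fun l => [set g : {ptws 'I_N -> V} | `|y l - g l| < d]) _ FF) => l.
    have /cvgrPdist_lt/(_ d d0) := @proj_continuous 'I_N (fun=> V) l y.
    by [].
  have [z [Bz [n _ nz]]] : (interior B `&` range (fun n =>
      (fun l => iter n (T l) x) : {ptws 'I_N -> V})) !=set0.
    by apply: dT; [exists y; exact: yB | exact: open_interior].
  by exists n => l; have := interior_subset Bz; rewrite -nz => /(_ l).
(* The filter of boxes around y converges to y in each coordinate, hence in the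
   product topology: every neighbourhood of y contains a box. *)
pose F := filter_from [set: {posnum K}]
  (fun d => [set g : 'I_N -> V | forall l, `|y l - g l| < d%:num]).
have FF : Filter F.
  apply: filter_from_filter; first by exists 1%:pos.
  move=> d1 d2 _ _; exists (Num.min d1 d2) => // g /= gd.
  by split => l; rewrite (lt_le_trans (gd l))// num_le ge_min lexx ?orbT.
have Fy : {ptws, F --> y}.
  rewrite cvg_sup => l; rewrite cvg_image; last first.
    by rewrite eqEsubset; split => // v _; exists (fun=> v).
  move=> A /nbhs_normP[d /= d0 dA]; exists (@^~ l @^-1` A).
    by exists (PosNum d0) => // g /= /(_ l); exact: dA.
  by rewrite eqEsubset; split => [_ [g + <-]//|v Av]; exists (fun=> v).
have [d _ dO] : F O by apply: Fy; exact: open_nbhs_nbhs.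
have [n nP] := dT y d%:num (gt0 _).
by exists (fun l => iter n (T l) x); split; [exact: dO|exists n].
Qed.

(** * The d-Hypercyclicity Criterion *)

Lemma cvg_sum0 (K : numFieldType) (V : normedModType K) (T : Type)
    (F : set_system T) (FF : Filter F) (J : Type) (s : seq J)
    (f : J -> T -> V) :
  (forall j, f j t @[t --> F] --> (0 : V)) ->
  \sum_(j <- s) f j t @[t --> F] --> (0 : V).
Proof.
move=> f0; elim: s => [|j s IH].
  under eq_fun do rewrite big_nil; exact: cvg_cst.
under eq_fun do rewrite big_cons; have := cvgD (f0 j) IH; rewrite addr0; exact.
Qed.

Lemma iter_linear (K : pzRingType) (V : lmodType K) (f : V -> V) n :
  linear f -> linear (iter n f).
Proof. by move=> fL; elim: n => [//|n IH] a x y; rewrite !iterS IH fL. Qed.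

HB.instance Definition _ (K : pzRingType) (V : lmodType K)
    (f : {linear V -> V}) n :=
  GRing.isLinear.Build K V V *:%R (iter n f)
    (iter_linear n (@linearP _ _ _ _ f)).

Lemma iter_continuous (V : topologicalType) (f : V -> V) n :
  continuous f -> continuous (iter n f).
Proof.
move=> fC; elim: n => [|n IH] x; first exact: cvg_id.
by apply: (@cvg_comp _ _ _ (iter n f) f); [exact: IH|exact: fC].
Qed.

Section Criterion.
Context {R : realType} {V : completeNormedModType R[i]} {N : nat}.
Variables (T : 'I_N -> {linear V -> V}).
Hypothesis T_cont : forall l, continuous (T l).

(** The point [y] is [y0 + \sum_i S i k (w i)] for a large [k], with [y0] in the
    first dense set near [x] and [w i] in the [i]-th one near [z i]. *)
Lemma criterion_approx (x : V) (z : 'I_N -> V) (d : R[i]) :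
  d_hypercyclicity_criterion T -> 0 < d ->
  exists2 y, `|x - y| < d & exists n, forall l, `|z l - iter n (T l) y| < d.
Proof.
move=> [n [_ [X0 [Xl [S [[dX0 dXl] T0 S0 TS]]]]]] d0.
have d20 : 0 < d / 2 by rewrite divr_gt0.
have [y0 y0X xy0] := (dense_normP X0).1 dX0 x _ d20.
have /choice[w wP] l : exists w, Xl l w /\ `|z l - w| < d / 2.
  by have [w] := (dense_normP (Xl l)).1 (dXl l) (z l) _ d20; exists w.
pose u k := y0 + \sum_i S i k (w i).
have uy0 : u k - y0 @[k --> \oo] --> (0 : V).
  rewrite /u; under eq_fun do rewrite addrC addKr.
  by apply: cvg_sum0 => i; apply: S0; have [] := wP i.
have Tu l : iter (n k) (T l) (u k) - w l @[k --> \oo] --> (0 : V).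
  have -> : (fun k => iter (n k) (T l) (u k) - w l) =
      fun k => iter (n k) (T l) y0
        + \sum_i (iter (n k) (T l) (S i k (w i)) - (i == l)%:R *: w i).
    apply/funext => k; rewrite raddfD raddf_sum sumrB /= -addrA.
    congr (_ + (_ - _)); rewrite (bigD1 l)//= eqxx scale1r big1 ?addr0//.
    by move=> i /negbTE ->; rewrite scale0r.
  rewrite -[X in _ --> X]addr0; apply: cvgD; first exact: T0.
  by apply: cvg_sum0 => i; apply: TS; have [] := wP i.
have near1 : \forall k \near \oo, `|u k - y0| < d / 2 by exact: cvgr0_norm_lt.
have near2 : \forall k \near \oo, forall l,
    `|iter (n k) (T l) (u k) - w l| < d / 2.
  apply: (@filter_forall _ _
    (fun l => [set k | `|iter (n k) (T l) (u k) - w l| < d / 2])) => l.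
  exact: cvgr0_norm_lt.
have [k [k1 k2]] := filter_ex (filterI near1 near2).
exists (u k); last exists (n k) => l.
  by rewrite (splitr d) (le_lt_trans (ler_distD y0 _ _))// ltrD// distrC.
rewrite (splitr d) (le_lt_trans (ler_distD (w l) _ _))// ltrD//.
  by have [] := wP l.
by rewrite distrC k2.
Qed.

(** The countable dense family [D] reduces d-hypercyclicity to countably many
    open conditions [G (c, m)]: some iterate lies in the box of radius
    [1 / m.+1] around the points [D (c l)].  Each of them is dense by
    [criterion_approx]. *)
Lemma criterion_densely_d_hypercyclic (C : countType) (D : C -> V) :
  (forall x d, 0 < d -> exists c, `|x - D c| < d) ->
  d_hypercyclicity_criterion T -> densely_d_hypercyclic T.
Proof.
move=> dD crit.
pose G (p : {ffun 'I_N -> C} * nat) := [set x : V | exists n, forall l,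
  `|D (p.1 l) - iter n (T l) x| < p.2.+1%:R^-1].
pose F k := if unpickle k is Some p then G p else setT.
have odF k : open (F k) /\ dense (F k).
  rewrite /F; case: unpickle => [[c m]|]; last first.
    by split; [exact: openT|move=> O ?; rewrite setIT].
  split.
    rewrite openE => x [n xn]; rewrite /interior.
    have near_x : \forall y \near x, forall l,
        `|D (c l) - iter n (T l) y| < m.+1%:R^-1.
      apply: (@filter_forall _ _ (fun l =>
        [set y | `|D (c l) - iter n (T l) y| < m.+1%:R^-1])) => l.
      pose e := m.+1%:R^-1 - `|D (c l) - iter n (T l) x|.
      have e0 : 0 < e by rewrite subr_gt0; exact: xn.
      have /cvgrPdist_lt/(_ e e0) : iter n (T l) @ x --> iter n (T l) x.
        exact: iter_continuous.
      apply: filterS => y /= xy.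
      rewrite (le_lt_trans (ler_distD (iter n (T l) x) _ _))//.
      by rewrite -ltrBrDl.
    by apply: filterS near_x => y yn; exists n.
  apply/dense_normP => x d d0.
  have [n1 n1d] := complex_invn_lt d0.
  pose t : R[i] := (maxn n1 m).+1%:R^-1.
  have t0 : 0 < t by rewrite invr_gt0 ltr0n.
  have [y xy [n yn]] := criterion_approx x (fun l => D (c l)) crit t0.
  exists y; last first.
    by apply: lt_le_trans xy (le_trans _ (ltW n1d));
      rewrite lef_pV2 ?posrE ?ltr0n// ler_nat ltnS leq_maxl.
  exists n => l; apply: lt_le_trans (yn l) _.
  by rewrite lef_pV2 ?posrE ?ltr0n// ler_nat ltnS leq_maxr.
have sub : \bigcap_k F k `<=` [set x | d_hypercyclic_vector T x].
  move=> x Fx; apply/d_hypercyclic_vectorP => y d d0.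
  have d20 : 0 < d / 2 by rewrite divr_gt0.
  have /choice[c cP] l := dD (y l) _ d20.
  have [m md] := complex_invn_lt d20.
  have := Fx (pickle ([ffun l => c l] : {ffun 'I_N -> C}, m)) I.
  rewrite /F pickleK => -[n /= nP]; exists n => l.
  rewrite (splitr d) (le_lt_trans (ler_distD (D (c l)) _ _))// ltrD//.
  by rewrite (lt_trans _ md)//; have := nP l; rewrite ffunE.
have dHC : dense [set x | d_hypercyclic_vector T x].
  by move=> O O0 oO; have [x [Ox /sub]] := complex_Baire odF O0 oO; exists x.
split => //; have [x [_ hx]] := dHC setT (ex_intro _ 0 I) openT.
split; last by exists x.
move=> l; exists x; apply/dense_normP => y d d0.
have [n nP] := (d_hypercyclic_vectorP T x).1 hx (fun=> y) d d0.
by exists (iter n (T l) x); [exists n|exact: nP].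
Qed.

End Criterion.

(** * Separability *)

Lemma complex_rat_approx (R : realType) (z d : R[i]) : 0 < d ->
  exists q : rat * rat, `|z - ((ratr q.1 : R) +i* (ratr q.2 : R))%C| < d.
Proof.
move=> d0; have [n nd] := complex_invn_lt d0.
pose t : R := n.+1%:R^-1 / 2.
have t0 : 0 < t by rewrite divr_gt0 ?invr_gt0 ?ltr0n.
have approx (a : R) : exists q : rat, `|a - ratr q| < t.
  have [y [aq [q _ qy]]] := @dense_rat R (ball a t)
    (ex_intro _ a (ballxx a t0)) (ball_open a t).
  by exists q; rewrite qy; rewrite -ball_normE in aq.
have [p zp] := approx (complex.Re z); have [q zq] := approx (complex.Im z).
exists (p, q); apply: lt_trans nd.
have normR (a : R) : `|a%:C%C| = `|a|%:C%C :> R[i].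
  by rewrite normc_def /= expr0n addr0 sqrtr_sqr.
rewrite [X in `|X|]complexE (le_lt_trans (ler_normD _ _))// normrM.
have -> : `|'i%C : R[i]| = 1.
  by rewrite normc_def /= expr0n add0r expr1n sqrtr1.
case: z zp zq => a c /= zp zq; rewrite mul1r !normR -rmorphD.
have -> : n.+1%:R^-1 = (t + t)%:C%C :> R[i].
  by rewrite /t -splitr fmorphV rmorph_nat.
by rewrite ltcR ltrD.
Qed.

(** Linear combinations with coefficients in [Q + iQ] are encoded by finite
    sequences of pairs (index, coefficient), which form a countable type. *)
Lemma countable_dense_span (R : realType) (I : countType)
    (V : normedModType R[i]) (e : I -> V) :
  dense [set x | exists (s : seq I) (c : I -> R[i]),
    x = \sum_(i <- s) c i *: e i] ->
  exists (D : seq (I * (rat * rat)) -> V),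
    forall x d, 0 < d -> exists s, `|x - D s| < d.
Proof.
move=> /dense_normP de.
pose D (s : seq (I * (rat * rat))) :=
  \sum_(p <- s) ((ratr p.2.1 : R) +i* (ratr p.2.2 : R))%C *: e p.1.
exists D => x d d0; have d20 : 0 < d / 2 by rewrite divr_gt0.
have [y [s [c ->]] xy] := de x _ d20.
suff [s' ss'] : exists s', `|\sum_(i <- s) c i *: e i - D s'| < d / 2.
  exists s'; rewrite (splitr d).
  by rewrite (le_lt_trans (ler_distD (\sum_(i <- s) c i *: e i) _ _))// ltrD.
elim: s (d / 2) d20 {xy} => [|i s IH] t t0.
  by exists [::]; rewrite /D !big_nil subrr normr0.
have [s' ss'] := IH (t / 2) (divr_gt0 t0 (ltr0n _ 2)).
have e0 : 0 < `|e i| + 1 by rewrite ltr_wpDl.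
have [q cq] := complex_rat_approx (c i) (divr_gt0 (divr_gt0 t0 (ltr0n _ 2)) e0).
exists ((i, q) :: s'); rewrite /D !big_cons opprD addrACA -scalerBl (splitr t).
rewrite (le_lt_trans (ler_normD _ _))// ltrD// normrZ.
rewrite ltr_pdivlMr// in cq; apply: le_lt_trans cq.
by rewrite ler_wpM2l// lerDl.
Qed.

(** * Orbits and weights along them *)

Lemma iter_inj (A : Type) (f : A -> A) n : injective f -> injective (iter n f).
Proof. by move=> fI; elim: n => // n IH x y /= /fI /IH. Qed.

Section PseudoShift.
Context {I : Type} {phi : I -> I}.

Lemma fwd_weightS (K : comNzRingType) (b : I -> K) m i :
  fwd_weight b phi m.+1 i = b i * fwd_weight b phi m (phi i).
Proof.
rewrite /fwd_weight big_nat_recl//; congr (_ * _).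
by apply: eq_bigr => v _; rewrite iterSr.
Qed.

Lemma fwd_weightD (K : comNzRingType) (b : I -> K) m n i :
  fwd_weight b phi (m + n) i =
  fwd_weight b phi m i * fwd_weight b phi n (iter m phi i).
Proof.
elim: m i => [|m IH] i; first by rewrite add0n {2}/fwd_weight big_geq// mul1r.
by rewrite addSn !fwd_weightS IH -mulrA -iterSr.
Qed.

Lemma fwd_weight_neq0 (K : fieldType) (b : I -> K) m i :
  (forall i, b i != 0) -> fwd_weight b phi m i != 0.
Proof.
move=> b0; rewrite /fwd_weight; elim/big_rec: _ => [|v x _ x0].
  exact: oner_neq0.
by rewrite mulf_neq0.
Qed.

Hypothesis phi_inj : injective phi.

Lemma partial_inverseP i j : partial_inverse phi i = Some j <-> phi j = i.
Proof.
rewrite /partial_inverse; case: pselect => [h|h]; last first.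
  by split => // ji; case: h; exists j.
case: cid => k /= <-; split => [[->]//|/phi_inj ->//].
Qed.

Lemma psi_iterP m i j : psi_iter phi m i = Some j <-> iter m phi j = i.
Proof.
elim: m j => [|m IH] j; first by split => [[]|/= ->].
rewrite /psi_iter iterS -/(psi_iter phi m i) iterSr.
case E: (psi_iter phi m i) => [k|] /=.
  have <- := (IH k).1 E; rewrite partial_inverseP.
  split => [->//|]; have : injective (iter m phi) by exact: iter_inj.
  by move=> /[apply].
by split => // /IH; rewrite E.
Qed.

(** Both products run over the orbit segment [j, .., iter m.-1 phi j], in
    opposite orders. *)
Lemma bwd_weight_iter (K : comNzRingType) (b : I -> K) m j :
  bwd_weight b phi m (iter m phi j) = fwd_weight b phi m j.
Proof.
rewrite /bwd_weight /fwd_weight big_add1 [m.+1.-1]/= [RHS]big_nat_rev add0n.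
apply: eq_big_nat => v /andP[_ vm].
suff -> : psi_iter phi v.+1 (iter m phi j) = Some (iter (m - v.+1) phi j) by [].
by apply/psi_iterP; rewrite -iterD subnKC.
Qed.

End PseudoShift.

Lemma near_all_seq (A : eqType) (T : Type) (F : set_system T) (FF : Filter F)
    (s : seq A) (P : A -> T -> Prop) :
  (forall a, \forall t \near F, P a t) ->
  \forall t \near F, forall a, a \in s -> P a t.
Proof.
move=> PF; elim: s => [|a s IH]; first exact: nearW.
near=> t => c; rewrite inE => /predU1P[->|cs]; first by near: t.
by move: c cs; near: t.
Unshelve. all: by end_near. Qed.

(** Two visits of the orbit at [j] would make [j] periodic. *)
Lemma iter_escape (A : Type) (phi : A -> A) i j : ~ periodic_point phi j ->
  \forall m \near \oo, iter m phi i <> j.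
Proof.
move=> jP; case: (pselect (exists m, iter m phi i = j)) => [[m0 m0j]|no].
  exists m0.+1 => // m /= m0m mj; apply: jP; exists (m - m0)%N.
    by rewrite subn_gt0.
  by rewrite -{1}m0j -iterD subnK// ltnW.
by apply: nearW => m mj; apply: no; exists m.
Qed.

(** Up to powers of [q] there are only [p] terms.  When [|q| <= 1] the sequence
    is bounded; when [|q| >= 1] its nonzero terms stay away from [0]. *)
Lemma multiplicative_recurrence_not_dense (K : numFieldType) (a : nat -> K)
    (q : K) (p : nat) :
  (0 < p)%N -> (forall m, a (p + m)%N = q * a m) ->
  exists z : K, exists2 d, 0 < d & forall m, d <= `|z - a m|.
Proof.
move=> p0 aq.
have a_mod m : exists2 s, (s < p)%N & exists k, a m = q ^+ k * a s.
  elim/ltn_ind: m => m IH; have [mp|pm] := ltnP m p.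
    by exists m => //; exists 0%N; rewrite expr0 mul1r.
  have mpm : (m - p < m)%N by rewrite ltn_subrL p0 (leq_trans p0).
  have [s sp [k mk]] := IH _ mpm; exists s => //; exists k.+1.
  by rewrite exprS -mulrA -mk -aq subnKC.
have sumB (f : nat -> K) s : (s < p)%N -> (forall v, 0 <= f v) ->
    f s <= \sum_(v < p) f v.
  by move=> sp f0; rewrite (bigD1 (Ordinal sp))//= lerDl sumr_ge0.
have q_real : (`|q| <= 1) || (1 <= `|q|).
  by rewrite real_leVge ?realE ?normr_ge0 ?ler01.
case/orP: q_real => q1.
  (* The whole sequence lies in the disc of radius B around 0. *)
  pose B := \sum_(v < p) `|a v|.
  have B0 : 0 <= B by exact: sumr_ge0.
  exists (B + 1); exists 1 => // m; have [s sp [k ->]] := a_mod m.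
  apply: le_trans (lerB_dist _ _); rewrite ger0_norm ?addr_ge0//.
  rewrite lerBrDr addrC lerD2r normrM normrX.
  apply: (@le_trans _ _ `|a s|); first by rewrite ler_piMl// exprn_ile1.
  exact: (sumB (fun v => `|a v|)).
(* The nonzero terms have modulus at least t: as 0^-1 = 0, the sum S bounds the
   inverse moduli of the nonzero terms among the first p. *)
pose S := \sum_(v < p) `|a v|^-1.
have S0 : 0 <= S by apply: sumr_ge0 => v _; rewrite invr_ge0.
have S1 : 0 < S + 1 by rewrite ltr_wpDl.
pose t := (S + 1)^-1; have t0 : 0 < t by rewrite invr_gt0.
exists (t / 2); exists (t / 2) => [|m]; first by rewrite divr_gt0.
have [s sp [k ->]] := a_mod m; have [as0|as0] := eqVneq (a s) 0.
  by rewrite as0 mulr0 subr0 ger0_norm// ltW// divr_gt0.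
rewrite distrC; apply: le_trans (lerB_dist _ _).
rewrite (ger0_norm (ltW (divr_gt0 t0 _)))// lerBrDr -splitr normrM normrX.
apply: (@le_trans _ _ `|a s|); last by rewrite ler_peMl// exprn_ege1.
rewrite -[leRHS]invrK lef_pV2 ?posrE ?invr_gt0 ?normr_gt0//.
apply: (@le_trans _ _ S); last by rewrite lerDl.
by apply: (sumB (fun v => `|a v|^-1)) => // v; rewrite invr_ge0.
Qed.

(** * Iterates of weighted pseudo-shifts *)

Section SequenceSpace.
Context {R : realType} {I : countType} {X : banachSeqSpace R I} {e : I -> X}.
Hypothesis e_unit : unit_vectors e.

Section OneShift.
Context {b : I -> R[i]} {phi : I -> I} {T : {linear X -> X}}.
Hypothesis T_shift : weighted_pseudo_shift b phi T.

Lemma coord_iter m x i :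
  bss_coord X i (iter m T x) =
  fwd_weight b phi m i * bss_coord X (iter m phi i) x.
Proof.
have [_ _ _ TE] := T_shift.
elim: m i => [|m IH] i; first by rewrite /fwd_weight big_geq// mul1r.
by rewrite iterS TE IH fwd_weightS mulrA -iterSr.
Qed.

Lemma iter_unit_vector m i :
  iter m T (e i) = bwd_weight b phi m i *: bwd_vector e phi m i.
Proof.
have [_ _ phi_inj _] := T_shift.
apply: bss_coord_inj => k; rewrite coord_iter linearZ /= e_unit /bwd_vector.
case E: (psi_iter phi m i) => [j|] /=.
  have /(psi_iterP phi_inj) ij := E; rewrite -{1 2}ij e_unit bwd_weight_iter//.
  rewrite (inj_eq (iter_inj phi_inj)) /GRing.scale /=.
  by case: eqVneq => [->//|]; rewrite !mulr0.
rewrite linear0 scaler0; case: eqVneq => [ik|]; last by rewrite mulr0.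
by move/esym/(psi_iterP phi_inj) : ik; rewrite E.
Qed.

(** This right inverse of the iterate on unit vectors provides the maps
    [S_{l,k}] of the criterion. *)
Lemma iter_pseudo_shift_inv m i :
  iter m T ((fwd_weight b phi m i)^-1 *: e (iter m phi i)) = e i.
Proof.
have [_ b0 phi_inj _] := T_shift.
rewrite linearZ /= iter_unit_vector bwd_weight_iter// /bwd_vector.
have -> : psi_iter phi m (iter m phi i) = Some i by apply/psi_iterP.
by rewrite scalerA mulVf ?scale1r// fwd_weight_neq0.
Qed.

End OneShift.

Lemma coord_near i (x : X) (d : R[i]) : 0 < d ->
  \forall y \near x, `|bss_coord X i x - bss_coord X i y| < d.
Proof.
by move=> d0; have /cvgrPdist_lt/(_ d d0) := @bss_coord_continuous _ _ X i x.
Qed.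

(** Along a cycle of length [p] the coordinate at [i] of the orbit is multiplied
    by the constant [fwd_weight b phi p i] every [p] steps. *)
Lemma hypercyclic_no_periodic b phi (T : {linear X -> X}) r :
  weighted_pseudo_shift b phi T -> hypercyclic (iter r T) ->
  forall i, ~ periodic_point phi i.
Proof.
move=> Tsh [x /dense_normP xd] i [p p0 pi].
pose a m := bss_coord X i (iter m T x).
have aq m : a (p + m)%N = fwd_weight b phi p i * a m.
  by rewrite /a !(coord_iter Tsh) fwd_weightD pi -mulrA addnC iterD pi.
have [z [d d0 za]] := multiplicative_recurrence_not_dense p0 aq.
have /nbhs_normP[t /= t0 tz] := coord_near i (z *: e i) d0.
have [_ [n _ <-] nz] := xd (z *: e i) t t0.
have := tz _ nz; rewrite /= linearZ /= e_unit eqxx /GRing.scale /= mulr1.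
by rewrite -iterM => /(le_lt_trans (za _)); rewrite ltxx.
Qed.

End SequenceSpace.

(** * Sufficiency of the vanishing conditions *)

Section Equivalence.
Context {R : realType} {I : countType} {X : banachSeqSpace R I} {e : I -> X}.
Hypothesis e_basis : OP_basis e.
Context {N : nat} {r : 'I_N -> nat}.
Context {b : 'I_N -> I -> R[i]} {phi : 'I_N -> I -> I}.
Context {T : 'I_N -> {linear X -> X}}.
Hypothesis T_shift : forall l, weighted_pseudo_shift (b l) (phi l) (T l).

(** The image of [e i] under the right inverse of the [n]-th power of
    [T_l^(r_l)]. *)
Definition fwd_term l n i : X :=
  (fwd_weight (b l) (phi l) (r l * n) i)^-1 *: e (iter (r l * n) (phi l) i).

(** The image of [e i] under the [n]-th power of [T_l^(r_l)]. *)
Definition bwd_term l n i : X :=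
  bwd_weight (b l) (phi l) (r l * n) i *: bwd_vector e (phi l) (r l * n) i.

(** The image of [fwd_term s n i] under the [n]-th power of [T_l^(r_l)]. *)
Definition cross_term s l n i : X :=
  ((fwd_weight (b s) (phi s) (r s * n) i)^-1
   * bwd_weight (b l) (phi l) (r l * n) (iter (r s * n) (phi s) i))
  *: bwd_vector e (phi l) (r l * n) (iter (r s * n) (phi s) i).

(** The maps [S l k] act on [lin_span e] through a chosen representation [rep x]
    of each vector [x] as a linear combination, independent of [k].  Only
    their values at each fixed [x] enter the pointwise limits, so the choice of
    [rep x] is arbitrary. *)
Lemma criterion_of_terms (n : nat -> nat) : increasing_positive n ->
  (forall l i, fwd_term l (n k) i @[k --> \oo] --> (0 : X)) ->
  (forall l i, bwd_term l (n k) i @[k --> \oo] --> (0 : X)) ->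
  (forall s l i, s != l -> cross_term s l (n k) i @[k --> \oo] --> (0 : X)) ->
  d_hypercyclicity_criterion (fun l => iter (r l) (T l)).
Proof.
have [e_unit e_dense _] := e_basis.
move=> n_inc fwd0 bwd0 cross0; exists n; split => //.
have /choice[rep repP] (x : X) : exists p : seq I * (I -> R[i]),
    lin_span e x -> x = \sum_(i <- p.1) p.2 i *: e i.
  case: (pselect (lin_span e x)) => [[s [c xE]]|h].
    by exists (s, c).
  by exists ([::], fun=> 0).
pose S l k (x : X) := \sum_(i <- (rep x).1) (rep x).2 i *: fwd_term l (n k) i.
have scale0 (c : R[i]) (u : nat -> X) :
    u k @[k --> \oo] --> 0 -> c *: u k @[k --> \oo] --> (0 : X).
  by move=> u0; rewrite -[X in _ --> X](scaler0 X c); exact: cvgZl_tmp.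
exists (lin_span e), (fun=> lin_span e), S; split => //.
- move=> l _ [s [c ->]]; under eq_fun do rewrite -iterM mulnC linear_sum.
  apply: cvg_sum0 => i.
  under eq_fun do rewrite linearZ /= (iter_unit_vector e_unit (T_shift l)).
  exact/scale0/bwd0.
- by move=> l x _; apply: cvg_sum0 => i; exact/scale0/fwd0.
move=> l s x /repP xE; rewrite [X in X @ _ --> _](_ : _ = fun k =>
  \sum_(i <- (rep x).1) (rep x).2 i *:
     (iter (r l * n k) (T l) (fwd_term s (n k) i)
        - (s == l)%:R *: e i)); last first.
  apply/funext => k; rewrite -iterM mulnC linear_sum [in X in _ - X]xE.
  rewrite scaler_sumr -sumrB; apply: eq_bigr => i _.
  by rewrite linearZ /= scalerBr !scalerA mulrC.
apply: cvg_sum0 => i; apply: scale0; have [->|sl] := eqVneq s l.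
  under eq_fun do rewrite /fwd_term
    (iter_pseudo_shift_inv e_unit (T_shift l)) scale1r subrr.
  exact: cvg_cst.
under eq_fun do rewrite scale0r subr0 /fwd_term linearZ /=
  (iter_unit_vector e_unit (T_shift l)) scalerA.
exact: cross0.
Qed.

(** * Necessity of the vanishing conditions *)

(** Equicontinuity makes all the coordinate projections small at once, for
    infinitely many indices; plain continuity would give only finitely many. *)
Lemma OP_near (y : X) (d : R[i]) : 0 < d ->
  \forall x \near y, forall i,
    `|(bss_coord X i y - bss_coord X i x) *: e i| < d.
Proof.
move=> d0; have [_ _ e_eq] := e_basis.
have := e_eq y [set p | `|p.1 - p.2| < d] _.
have -> : [set p : X * X | `|p.1 - p.2| < d] = [set p | ball p.1 d p.2].
  by rewrite -ball_normE.
move=> /(_ (entourage_ball _ (PosNum d0))).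
by apply: filterS => x + i => /(_ i Logic.I); rewrite -ball_normE /= scalerBl.
Qed.

Lemma OP_near_seq (y : X) (s : seq I) (d : R[i]) : 0 < d ->
  exists2 t : R[i], 0 < t & forall x, `|y - x| < t ->
    (forall i, `|(bss_coord X i y - bss_coord X i x) *: e i| < d) /\
    (forall i, i \in s -> `|bss_coord X i y - bss_coord X i x| < 2^-1).
Proof.
move=> d0.
have near2 : \forall x \near y, forall i, i \in s ->
    `|bss_coord X i y - bss_coord X i x| < 2^-1.
  by apply: near_all_seq => i; apply: coord_near; rewrite invr_gt0.
have [t /= t0 tP] := (nbhs_normP _ _).1 (filterI (OP_near y d0) near2).
by exists t.
Qed.

Hypothesis r_ge1 : forall l, (1 <= r l)%N.
Hypothesis phi_aper : forall l i, ~ periodic_point (phi l) i.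
Hypothesis phi_run_away : forall s l : 'I_N, s != l ->
  run_away (iter (r s) (phi s)) (iter (r l) (phi l)).

Definition terms_lt (d : R[i]) n i :=
  [/\ forall l, `|fwd_term l n i| < d, forall l, `|bwd_term l n i| < d &
      forall s l, s != l -> `|cross_term s l n i| < d].

(** Without periodic points an orbit visits each index at most once
    ([iter_escape]), so it eventually leaves the finite set [F]; the second part
    is the run-away property for [F]. *)
Lemma escape_seq (F : seq I) : \forall n \near \oo, forall i j,
  i \in F -> j \in F ->
  (forall l, iter (r l * n) (phi l) i <> j) /\
  (forall s l, s != l ->
     iter (r s * n) (phi s) i <> iter (r l * n) (phi l) j).
Proof.
have esc l : \forall n \near \oo, forall i, i \in F -> forall j, j \in F ->
    iter (r l * n) (phi l) i <> j.
  apply: near_all_seq => i; apply: near_all_seq => j.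
  have [m0 _ m0P] := iter_escape i (@phi_aper l j).
  exists m0 => // n /= m0n; apply: m0P => /=.
  by rewrite (leq_trans m0n)// leq_pmull.
have run (s l : 'I_N) : s != l -> \forall n \near \oo, forall i, i \in F ->
    forall j, j \in F -> iter (r s * n) (phi s) i <> iter (r l * n) (phi l) j.
  move=> sl; have [n0 n0P] := phi_run_away sl (finite_seq F).
  exists n0 => // n /= n0n i iF j jF ij.
  have : (iter n (iter (r s) (phi s)) @` [set` F] `&`
          iter n (iter (r l) (phi l)) @` [set` F]) (iter (r s * n) (phi s) i).
    by split; [exists i|exists j] => //; rewrite ?ij -iterM mulnC.
  by rewrite n0P.
have escN : \forall n \near \oo, forall l i, i \in F ->
    forall j, j \in F -> iter (r l * n) (phi l) i <> j.
  by apply: (@filter_forall _ _ (fun l => [set n | forall i, i \in F ->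
    forall j, j \in F -> iter (r l * n) (phi l) i <> j])) => l; exact: esc.
have runN : \forall n \near \oo, forall p : 'I_N * 'I_N, p.1 != p.2 ->
    forall i, i \in F -> forall j, j \in F ->
    iter (r p.1 * n) (phi p.1) i <> iter (r p.2 * n) (phi p.2) j.
  apply: (@filter_forall _ _ (fun p : 'I_N * 'I_N => [set n | p.1 != p.2 ->
    forall i, i \in F -> forall j, j \in F ->
    iter (r p.1 * n) (phi p.1) i <> iter (r p.2 * n) (phi p.2) j])) => -[s l].
  have [->|sl] := eqVneq s l; first by apply: nearW => n /= /eqP.
  by apply: filterS (run s l sl) => n nP _.
apply: filterS2 escN runN => n nE nR i j iF jF; split => [l|s l sl].
  exact: nE.
exact: (nR (s, l) sl).
Qed.

Lemma unscale_lt (a d : R[i]) (v : X) : 2^-1 <= `|a| -> `|a *: v| < d / 2 ->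
  `|v| < d.
Proof.
move=> a2 avd; have : 2^-1 * `|v| < d / 2.
  by apply: le_lt_trans avd; rewrite normrZ ler_wpM2r.
by rewrite mulrC ltr_pM2r ?invr_gt0.
Qed.

(** Each vector to be estimated, multiplied by a coordinate of [x] or of one of
    its images at an index of [F], becomes a component [u_j *: e j] of such a
    vector at an index [j] outside [F]. *)
Lemma terms_lt_of_approx (F : seq I) (n : nat) (d : R[i]) (x : X) :
  (forall i j, i \in F -> j \in F ->
    (forall l, iter (r l * n) (phi l) i <> j) /\
    (forall s l, s != l ->
       iter (r s * n) (phi s) i <> iter (r l * n) (phi l) j)) ->
  (forall i, i \in F -> 2^-1 <= `|bss_coord X i x|) ->
  (forall j, j \notin F -> `|bss_coord X j x *: e j| < d / 2) ->
  (forall l i, i \in F -> 2^-1 <= `|bss_coord X i (iter (r l * n) (T l) x)|) ->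
  (forall l j, j \notin F ->
     `|bss_coord X j (iter (r l * n) (T l) x) *: e j| < d / 2) ->
  forall i, i \in F -> 0 < d -> terms_lt d n i.
Proof.
move=> esc xF xF' yF yF' i iF d0.
have W0 l j : fwd_weight (b l) (phi l) (r l * n) j != 0.
  by apply: fwd_weight_neq0; have [] := T_shift l.
have phi_inj l : injective (phi l) by have [] := T_shift l.
split => [l|l|s l sl].
- apply: (unscale_lt (yF l i iF)); rewrite (coord_iter (T_shift l)) /fwd_term.
  rewrite scalerA mulrAC mulfV// mul1r xF'//.
  by apply/negP => jF; have [/(_ l)] := esc _ _ iF jF.
- rewrite /bwd_term /bwd_vector; case E : psi_iter => [j|] /=; last first.
    by rewrite scaler0 normr0.
  have /(psi_iterP (phi_inj l)) ji := E.
  apply: (unscale_lt (xF i iF)); rewrite -ji bwd_weight_iter//.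
  rewrite scalerA mulrC -(coord_iter (T_shift l)) yF'//.
  by apply/negP => jF; have [/(_ l)] := esc _ _ jF iF.
rewrite /cross_term /bwd_vector; case E : psi_iter => [j|] /=; last first.
  by rewrite scaler0 normr0.
have /(psi_iterP (phi_inj l)) ji := E.
apply: (unscale_lt (yF s i iF)); rewrite (coord_iter (T_shift s)) -ji.
rewrite bwd_weight_iter// scalerA mulrA (mulrAC _ _ (_^-1)) mulfV// mul1r.
rewrite mulrC -(coord_iter (T_shift l)) yF'//.
apply/negP => jF; have [_ /(_ s l sl)] := esc _ _ iF jF.
by rewrite ji.
Qed.

(** The target [c *: z] has to be approached at a late time: [c] exceeds by at
    least [1] the moduli of the coordinates at [i0] of the first [n2.+1] points
    of the orbit of [x] under [iter (r l0) (T l0)], so none of these points is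
    close to [c *: z], whose coordinate at [i0] is [c]. *)
Lemma exists_terms_lt (l0 : 'I_N) (i0 : I) (F : seq I) (d : R[i]) (n0 : nat) :
  dense [set x | d_hypercyclic_vector (fun l => iter (r l) (T l)) x] ->
  0 < d -> exists2 n, (n0 < n)%N & forall i, i \in F -> terms_lt d n i.
Proof.
have [e_unit _ _] := e_basis.
move=> /dense_normP xdense d0; pose F1 := undup (i0 :: F).
have i0F : i0 \in F1 by rewrite mem_undup inE eqxx.
have d20 : 0 < d / 2 by rewrite divr_gt0.
pose z := \sum_(i <- F1) e i.
have zE j : bss_coord X j z = (j \in F1)%:R.
  rewrite /z linear_sum /=; under eq_bigr do rewrite e_unit.
  have [jF|jF] := boolP (j \in F1).
    rewrite (bigD1_seq j)//= ?undup_uniq// eqxx big1 ?addr0// => i.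
    by move=> /negbTE ->.
  rewrite big1_seq// => i /= iF; case: eqVneq => // ij.
  by rewrite -ij iF in jF.
have [n1 _ n1P] := escape_seq F1.
have [t t0 tP] := OP_near_seq z F1 d20.
have [x xhc /tP[xz1 xz2]] := xdense z t t0.
pose n2 := maxn n0 n1.
pose u n := bss_coord X i0 (iter n (iter (r l0) (T l0)) x).
pose c := \sum_(n < n2.+1) `|u n| + 1.
have c1 : 1 <= c by rewrite lerDr sumr_ge0.
have c0 : 0 <= c by exact: le_trans c1.
have [t' t'0 t'P] := OP_near_seq (c *: z) F1 d20.
have [n nP] := (d_hypercyclic_vectorP _ x).1 xhc (fun=> c *: z) t' t'0.
have {t'P nP} yP l := t'P _ (nP l).
have half : 2^-1 < 1 :> R[i] by rewrite invf_lt1 ?ltr1n.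
have n2n : (n2 < n)%N.
  rewrite ltnNge; apply/negP => nn2.
  have := (yP l0).2 _ i0F; rewrite linearZ /= zE i0F /GRing.scale /= mulr1.
  rewrite -/(u n); apply/negP.
  rewrite -real_leNgt ?realE ?normr_ge0 ?invr_ge0 ?ler0n//.
  apply: (le_trans (ltW half)); apply: le_trans (lerB_dist _ _).
  rewrite ger0_norm// lerBrDr addrC lerD2r.
  have nn2' : (n < n2.+1)%N by [].
  by rewrite (bigD1 (Ordinal nn2'))//= lerDl sumr_ge0.
exists n; first by rewrite (leq_ltn_trans _ n2n)// leq_maxl.
have n1n : (n1 <= n)%N by rewrite (leq_trans _ (ltnW n2n))// leq_maxr.
have ge_half (a w : R[i]) : 1 <= a -> `|a - w| < 2^-1 -> 2^-1 <= `|w|.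
  move=> a1 aw; have a0 : 0 <= a by exact: le_trans a1.
  have -> : 2^-1 = 1 - 2^-1 :> R[i] by rewrite {2}(splitr 1) mul1r addrK.
  rewrite lerBlDr (le_trans a1)// -[leLHS](ger0_norm a0) -{1}(subrK w a).
  by rewrite addrC (le_trans (ler_normD _ _))// lerD2l ltW.
have iterE l : iter (r l * n) (T l) x = iter n (iter (r l) (T l)) x.
  by rewrite mulnC iterM.
move=> i iF; apply: (@terms_lt_of_approx F1 n d x) => //.
- exact: n1P.
- by move=> j jF; apply: (ge_half 1) => //; have := xz2 j jF; rewrite zE jF.
- by move=> j jF; have := xz1 j; rewrite zE (negbTE jF) !normrZ sub0r normrN.
- move=> l j jF; apply: (ge_half c) => //; have := (yP l).2 j jF.
  by rewrite linearZ /= zE jF /GRing.scale /= mulr1 iterE.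
- move=> l j jF; have := (yP l).1 j; rewrite linearZ /= zE (negbTE jF) iterE.
  by rewrite [c *: _]mulr0 !normrZ sub0r normrN.
by rewrite mem_undup inE iF orbT.
Qed.

(** The finite sets exhausting [I] are those of the indices coded by the first
    [k] natural numbers. *)
Lemma vanishing_sequence :
  (forall (F : seq I) d n0, 0 < d ->
     exists2 n, (n0 < n)%N & forall i, i \in F -> terms_lt d n i) ->
  exists n : nat -> nat, increasing_positive n /\
    forall i d, 0 < d -> \forall k \near \oo, terms_lt d (n k) i.
Proof.
move=> H; pose F k : seq I := pmap unpickle (iota 0 k).
have /choice[g gP] (p : nat * nat) : exists n, (p.2 < n)%N /\
    forall i, i \in F p.1 -> terms_lt p.1.+1%:R^-1 n i.
  have [|n pn nP] := H (F p.1) p.1.+1%:R^-1 p.2; last by exists n.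
  by rewrite invr_gt0.
pose fix n k := if k is k'.+1 then g (k, n k') else g (0%N, 0%N).
have n_step k : (n k < n k.+1)%N by have [] := gP (k.+1, n k).
exists n; split.
  split; first exact: (homo_ltn ltn_trans).
  elim=> [|k IH]; first by have [] := gP (0%N, 0%N).
  exact: ltn_trans IH (n_step k).
move=> i d d0; have [m md] := complex_invn_lt d0.
exists (maxn m (pickle i).+1) => // k /=; rewrite geq_max => /andP[mk ik].
have kd : k.+1%:R^-1 <= d.
  by apply: le_trans (ltW md); rewrite lef_pV2 ?posrE ?ltr0n// ler_nat.
have iF : i \in F k.
  rewrite mem_pmap; apply/mapP; exists (pickle i); last by rewrite pickleK.
  by rewrite mem_iota.
have [f1 f2 f3] : terms_lt k.+1%:R^-1 (n k) i.
  by case: k ik {mk kd} iF => [//|k] ik iF; have [_] := gP (k.+1, n k); apply.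
split => [l|l|s l sl]; apply: lt_le_trans kd; [exact: f1|exact: f2|exact: f3].
Qed.

End Equivalence.

(** * The equivalence *)


Theorem theorem2p1 (R : realType) (I : countType) (I_infinite : infinite_set [set: I])
    (X : banachSeqSpace R I) (e : I -> X) (e_basis : OP_basis e)
    (N : nat) (N_ge2 : (2 <= N)%N)
    (r : 'I_N -> nat) (r_ge1 : forall l, (1 <= r l)%N)
    (r_incr : forall s l : 'I_N, (s < l)%N -> (r s < r l)%N)
    (b : 'I_N -> I -> R[i]) (phi : 'I_N -> I -> I) (T : 'I_N -> {linear X -> X})
    (T_shift : forall l, weighted_pseudo_shift (b l) (phi l) (T l))
    (phi_run_away : forall s l : 'I_N, (s < l)%N ->
       run_away (iter (r s) (phi s)) (iter (r l) (phi l))) :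
  [<-> densely_d_hypercyclic (fun l => iter (r l) (T l));
       (forall l i, ~ periodic_point (phi l) i) /\
       (exists n : nat -> nat, increasing_positive n /\
         forall i : I,
           (forall l : 'I_N,
              vanishes_in_norm (fun k =>
                (fwd_weight (b l) (phi l) (r l * n k) i)^-1
                  *: e (iter (r l * n k) (phi l) i)) /\
              vanishes_in_norm (fun k =>
                bwd_weight (b l) (phi l) (r l * n k) i
                  *: bwd_vector e (phi l) (r l * n k) i)) /\
           (forall s l : 'I_N, (s < l)%N ->
              vanishes_in_norm (fun k =>
                ((fwd_weight (b s) (phi s) (r s * n k) i)^-1
                 * bwd_weight (b l) (phi l) (r l * n k)
                     (iter (r s * n k) (phi s) i))
                  *: bwd_vector e (phi l) (r l * n k)
                       (iter (r s * n k) (phi s) i)) /\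
              vanishes_in_norm (fun k =>
                ((fwd_weight (b l) (phi l) (r l * n k) i)^-1
                 * bwd_weight (b s) (phi s) (r s * n k)
                     (iter (r l * n k) (phi l) i))
                  *: bwd_vector e (phi s) (r s * n k)
                       (iter (r l * n k) (phi l) i))));
       d_hypercyclicity_criterion (fun l => iter (r l) (T l))].
Proof.
have [e_unit e_dense _] := e_basis.
tfae.
- move=> [[hc _] dHC].
  have aper l i : ~ periodic_point (phi l) i.
    exact: (hypercyclic_no_periodic e_unit (T_shift l) (hc l)).
  split=> //.
  have run (s l : 'I_N) : s != l ->
      run_away (iter (r s) (phi s)) (iter (r l) (phi l)).
    rewrite neq_ltn => /orP[|ls]; first exact: phi_run_away.
    move=> F /(phi_run_away _ _ ls)[n0 n0P]; exists n0 => n /n0P.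
    by rewrite setIC.
  have [i0 _] := infinite_setN0 I_infinite.
  have [n [n_inc nP]] := vanishing_sequence (fun F d n0 d0 =>
    exists_terms_lt e_basis T_shift r_ge1 aper run
      (Ordinal (ltnW N_ge2)) i0 F n0 dHC d0).
  exists n; split => // i; split => [l|s l sl]; split;
    apply/norm_cvg0P/cvgr0Pnorm_lt => d d0;
    apply: filterS (nP i d d0) => k [f1 f2 f3]; [exact: f1|exact: f2| |].
    by apply: f3; rewrite neq_ltn sl.
  by apply: f3; rewrite neq_ltn sl orbT.
- move=> [_ [n [n_inc nP]]].
  apply: (criterion_of_terms e_basis T_shift n_inc).
  + by move=> l i; apply/norm_cvg0P; have [/(_ l)[]] := nP i.
  + by move=> l i; apply/norm_cvg0P; have [/(_ l)[]] := nP i.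
  move=> s l i; rewrite neq_ltn => /orP[sl|ls]; apply/norm_cvg0P.
    by have [_ /(_ s l sl)[]] := nP i.
  by have [_ /(_ l s ls)[]] := nP i.
move=> crit; have [D DP] := countable_dense_span e_dense.
apply: (@criterion_densely_d_hypercyclic _ X _ (fun l => iter (r l) (T l))
  _ _ D DP crit).
by move=> l; apply: iter_continuous; have [] := T_shift l.
Qed.
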